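(* Let $(M^n,g)$ be a Hermitian manifold (not necessarily compact). If there are two real values $r\neq r'$ such that the Gauduchon connections $D^{r}$ and $D^{r'}$ are both Kähler-like, then $g$ is Kähler.
   Context: Let $(M^n,g)$ be a Hermitian manifold with complex structure $J$. The Chern connection $\nabla^c$ is the unique connection $D$ with $Dg=0$, $DJ=0$ whose torsion has no $(1,1)$-component. The Strominger (Bismut) connection $\nabla^s$ is the unique connection $D$ with $Dg=0$, $DJ=0$ whose torsion is totally skew-symmetric (i.e. $g(T^D(x,y),z)$ is a $3$-form). For $r\in\mathbb{R}$ the Gauduchon connection is $D^{r}=\frac{1+r}{2}\nabla^c+\frac{1-r}{2}\nabla^s$. A connection $D$ with $Dg=0$ is called Kähler-like if its curvature tensor $R^D(x,y,z,w)=g(R^D(x,y)z,w)$ satisfies, for all real tangent vectors $x,y,z,w$: $R^D(x,y,z,w)+R^D(y,z,x,w)+R^D(z,x,y,w)=0$ and $R^D(Jx,Jy,z,w)=R^D(x,y,z,w)=R^D(x,y,Jz,Jw)$. *)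

(* Defs.v *)
From HB Require Import structures.
From mathcomp Require Import all_boot all_order all_algebra.
From mathcomp Require Import all_classical all_reals all_analysis.

Set Implicit Arguments.
Unset Strict Implicit.
Unset Printing Implicit Defensive.
Import Order.TTheory GRing.Theory Num.Theory.
Import numFieldNormedType.Exports.
Local Open Scope classical_set_scope.
Local Open Scope ring_scope.

(* C^n is modelled on R^(2n): row_mx x y stands for x + iy, and J0 is
   multiplication by i. *)
Definition J0 (R : realType) (n : nat) (u : 'rV[R]_(n + n)) : 'rV[R]_(n + n) :=
  row_mx (- rsubmx u) (lsubmx u).

(* f is C^infinity on the open set A: all its iterated directional
   derivatives, including f itself, are (Frechet) differentiable on A. *)
Definition smooth_on (R : realType) (V W : normedModType R) (A : set V)
    (f : V -> W) : Prop :=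
  forall (vs : seq V) (x : V), A x ->
    differentiable (foldr (fun v (h : V -> W) => fun y => 'D_v h y) f vs) x.

(* A map between open subsets of C^n is holomorphic when it is differentiable
   with complex linear differential. *)
Definition holomorphic_on (R : realType) (n : nat) (A : set 'rV[R]_(n + n))
    (f : 'rV[R]_(n + n) -> 'rV[R]_(n + n)) : Prop :=
  forall p, A p ->
    differentiable f p /\ forall u, 'd f p (J0 u) = J0 ('d f p u).

(* A complex manifold of complex dimension n, given by a holomorphic atlas.
   chart i and chartV i are only meaningful on dom i and on its image. *)
Record complexManifold (R : realType) (n : nat) := ComplexManifold {
  carrier :> topologicalType;
  chart_index : Type;
  dom : chart_index -> set carrier;
  chart : chart_index -> carrier -> 'rV[R]_(n + n);
  chartV : chart_index -> 'rV[R]_(n + n) -> carrier;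
  carrier_hausdorff : hausdorff_space carrier;
  carrier_second_countable : @second_countable carrier;
  dom_open : forall i, open (dom i);
  dom_cover : forall x, exists i, dom i x;
  image_open : forall i, open (chart i @` dom i);
  chartK : forall i x, dom i x -> chartV i (chart i x) = x;
  chart_continuous : forall i x, dom i x -> {for x, continuous (chart i)};
  chartV_continuous : forall i p, (chart i @` dom i) p ->
    {for p, continuous (chartV i)};
  transition_holomorphic : forall i j,
    holomorphic_on (chart i @` (dom i `&` dom j)) (chart j \o chartV i)
}.

Definition chart_image (R : realType) (n : nat) (M : complexManifold R n)
  (i : chart_index M) : set 'rV[R]_(n + n) := chart i @` dom i.

Definition chart_overlap (R : realType) (n : nat) (M : complexManifold R n)
  (i j : chart_index M) : set 'rV[R]_(n + n) := chart i @` (dom i `&` dom j).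

Definition transition (R : realType) (n : nat) (M : complexManifold R n)
  (i j : chart_index M) : 'rV[R]_(n + n) -> 'rV[R]_(n + n) :=
  chart j \o chartV i.

(* Tangent vectors at a point are represented by their components in a chart
   around it; since the charts are holomorphic, the complex structure J is J0 in
   every chart. metric i p u v is the value of g on the tangent vectors with
   components u, v at the point of coordinates p in the chart i. *)
Record hermitianManifold (R : realType) (n : nat) := HermitianManifold {
  manifold :> complexManifold R n;
  metric : chart_index manifold ->
    'rV[R]_(n + n) -> 'rV[R]_(n + n) -> 'rV[R]_(n + n) -> R;
  metric_linear : forall i p, chart_image i p -> forall a u v w,
    metric i p (a *: u + v) w = a * metric i p u w + metric i p v w;
  metric_sym : forall i p, chart_image i p -> forall u v,
    metric i p u v = metric i p v u;
  metric_pos : forall i p, chart_image i p -> forall u, u != 0 ->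
    0 < metric i p u u;
  metric_J : forall i p, chart_image i p -> forall u v,
    metric i p (J0 u) (J0 v) = metric i p u v;
  metric_smooth : forall i u v,
    smooth_on (chart_image i) (fun p => metric i p u v : R^o);
  metric_transition : forall i j p, chart_overlap i j p -> forall u v,
    metric i p u v =
    metric j (transition i j p) ('d (transition i j) p u)
                                ('d (transition i j) p v)
}.

(* An affine connection on the tangent bundle, given in each chart by
   D_X Y = dY(X) + Gamma(X, Y) (cf. cov below); the last field says that these
   local expressions define the same operator on the overlaps. *)
Record connection (R : realType) (n : nat) (M : complexManifold R n) :=
  Connection {
  christoffel : chart_index M ->
    'rV[R]_(n + n) -> 'rV[R]_(n + n) -> 'rV[R]_(n + n) -> 'rV[R]_(n + n);
  christoffel_linearl : forall i p, chart_image i p -> forall a u v w,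
    christoffel i p (a *: u + v) w =
    a *: christoffel i p u w + christoffel i p v w;
  christoffel_linearr : forall i p, chart_image i p -> forall a u v w,
    christoffel i p w (a *: u + v) =
    a *: christoffel i p w u + christoffel i p w v;
  christoffel_smooth : forall i u v,
    smooth_on (chart_image i) (fun p => christoffel i p u v);
  christoffel_transition : forall i j p, chart_overlap i j p -> forall u v,
    'd (transition i j) p (christoffel i p u v) =
    'D_u (fun q => 'D_v (transition i j) q) p +
    christoffel j (transition i j p) ('d (transition i j) p u)
                                     ('d (transition i j) p v)
}.

Section LocalCalculus.
Variables (R : realType) (n : nat) (M : complexManifold R n).
Variables (D : connection M) (i : chart_index M).
Local Notation V := 'rV[R]_(n + n).
Implicit Types X Y Z : V -> V.

(* D_X Y, [X, Y], T(X, Y) and R(X, Y)Z for vector fields X, Y, Z written in the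
   chart i. *)
Definition cov X Y : V -> V :=
  fun p => 'D_(X p) Y p + christoffel D i p (X p) (Y p).

Definition lie_bracket X Y : V -> V :=
  fun p => 'D_(X p) Y p - 'D_(Y p) X p.

Definition torsion X Y : V -> V :=
  fun p => cov X Y p - cov Y X p - lie_bracket X Y p.

Definition curvature X Y Z : V -> V :=
  fun p => cov X (cov Y Z) p - cov Y (cov X Z) p - cov (lie_bracket X Y) Z p.

(* Torsion and curvature are tensors: their values on tangent vectors are
   computed by extending these to vector fields with constant components. *)
Definition torsion_at (p x y : V) : V := torsion (cst x) (cst y) p.

Definition curvature_at (p x y z : V) : V :=
  curvature (cst x) (cst y) (cst z) p.

End LocalCalculus.

Section Predicates.
Variables (R : realType) (n : nat) (M : hermitianManifold R n).
Implicit Types D : connection M.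
Local Notation V := 'rV[R]_(n + n).

(* D g = 0: x (g(Y, Z)) = g(D_x Y, Z) + g(Y, D_x Z), which is tensorial in Y and
   Z, tested on fields with constant components. *)
Definition metric_parallel D : Prop :=
  forall (i : chart_index M) (p : V), chart_image i p -> forall x y z : V,
  'D_x (fun q => metric i q y z : R^o) p =
  metric i p (cov D i (cst x) (cst y) p) z +
  metric i p y (cov D i (cst x) (cst z) p).

(* D J = 0: D_x (J Y) = J (D_x Y), tensorial in Y as well. *)
Definition J_parallel D : Prop :=
  forall (i : chart_index M) (p : V), chart_image i p -> forall x y : V,
  cov D i (cst x) (fun q => J0 (cst y q)) p = J0 (cov D i (cst x) (cst y) p).

(* The (1,1)-component of a vector-valued 2-form T: on T^{1,0} x T^{0,1} one has
   T(J., J.) = T, whereas T(J., J.) = - T on pairs of vectors of equal type. *)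
Definition part11 (T : V -> V -> V) (x y : V) : V :=
  2^-1 *: (T x y + T (J0 x) (J0 y)).

Definition is_chern D : Prop :=
  [/\ metric_parallel D, J_parallel D &
      forall (i : chart_index M) (p : V), chart_image i p ->
      forall x y : V, part11 (torsion_at D i p) x y = 0].

(* g(T(x, y), z) is always trilinear and skew-symmetric in x, y; skew-symmetry
   under the two transpositions makes it a 3-form. *)
Definition is_strominger D : Prop :=
  [/\ metric_parallel D, J_parallel D &
      forall (i : chart_index M) (p : V), chart_image i p ->
      let t x y z := metric i p (torsion_at D i p x y) z in
      forall x y z : V, t y x z = - t x y z /\ t x z y = - t x y z].

Definition kahler_like D : Prop :=
  metric_parallel D /\
  forall (i : chart_index M) (p : V), chart_image i p ->
  let Rm x y z w := metric i p (curvature_at D i p x y z) w in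
  forall x y z w : V,
  [/\ Rm x y z w + Rm y z x w + Rm z x y w = 0,
      Rm (J0 x) (J0 y) z w = Rm x y z w &
      Rm x y z w = Rm x y (J0 z) (J0 w)].

(* The fundamental form omega(x, y) = g(Jx, y), and its exterior derivative on
   coordinate (hence commuting) vector fields. *)
Definition fundamental_form (i : chart_index M) (p x y : V) : R :=
  metric i p (J0 x) y.

Definition d_fundamental_form (i : chart_index M) (p x y z : V) : R :=
  'D_x (fun q => fundamental_form i q y z : R^o) p +
  'D_y (fun q => fundamental_form i q z x : R^o) p +
  'D_z (fun q => fundamental_form i q x y : R^o) p.

Definition is_kahler : Prop :=
  forall (i : chart_index M) (p : V), chart_image i p ->
  forall x y z : V, d_fundamental_form i p x y z = 0.

End Predicates.

Section Gauduchon.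
Variables (R : realType).

Lemma near_eq_differentiable (V W : normedModType R) (f g : V -> W) (x : V) :
  (\forall y \near x, f y = g y) -> differentiable f x -> differentiable g x.
Proof.
move=> fg df.
have h0 : (g - f) \o shift x = cst ((g - f) x) + (\0 : V -> W) +o_ (0 : V) id.
  apply/eqaddoP => _/posnumP[e].
  have fg0 : \forall y \near (0 : V), f (y + x) = g (y + x).
    have : {for 0 : V, continuous (fun y => y + x)}.
      by apply: cvgD; [exact: cvg_id|exact: cvg_cst].
    by rewrite /prop_for /continuous_at add0r => /(_ _ fg).
  near=> y.
  rewrite !fctE /= -(near fg0 y)// -(nbhs_singleton fg)// !subrr !addr0 subrr.
  by rewrite normr0 mulr_ge0.
have dh : differentiable (g - f) x.
  apply/diff_locallyP; have -> := diff_unique _ h0; last first.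
    by move=> ?; exact: cvg_cst.
  by split=> [?|]; [exact: cvg_cst|exact: h0].
by rewrite -[g](subrK f); exact: differentiableD.
Unshelve. all: by end_near. Qed.

Lemma smooth_on_lincomb (V W : normedModType R) (A : set V) (f g : V -> W)
    (a b : R) : open A -> smooth_on A f -> smooth_on A g ->
  smooth_on A (fun x => a *: f x + b *: g x).
Proof.
move=> oA sf sg vs.
pose it (h : V -> W) ws := foldr (fun v (h : V -> W) => fun y => 'D_v h y) h ws.
have dlc ws x : A x -> differentiable (a *: it f ws + b *: it g ws) x.
  move=> Ax; apply: differentiableD; apply: differentiableZ.
    exact: (sf ws x Ax).
  exact: (sg ws x Ax).
have itE ws x : A x ->
    it (fun x => a *: f x + b *: g x) ws x = (a *: it f ws + b *: it g ws) x.
  elim: ws x => [//|v ws IH] x Ax /=.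
  have dfx : derivable (it f ws) x v by apply: diff_derivable; exact: sf.
  have dgx : derivable (it g ws) x v by apply: diff_derivable; exact: sg.
  rewrite (near_eq_derive v (g := a *: it f ws + b *: it g ws)).
    rewrite deriveD; [|exact: derivableZ..].
    by rewrite !deriveZ.
  by near=> y; apply: IH; near: y; exact: open_nbhs_nbhs.
move=> x Ax; apply: near_eq_differentiable (dlc vs x Ax).
by near=> y; apply/esym/itE; near: y; exact: open_nbhs_nbhs.
Unshelve. all: by end_near. Qed.

Variables (n : nat) (M : complexManifold R n) (Dc Ds : connection M) (r : R).
Local Notation V := 'rV[R]_(n + n).

Definition gauduchon_christoffel (i : chart_index M) (p u v : V) : V :=
  ((1 + r) / 2) *: christoffel Dc i p u v +
  ((1 - r) / 2) *: christoffel Ds i p u v.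

Fact gauduchon_linearl i p : chart_image i p -> forall a u v w,
  gauduchon_christoffel i p (a *: u + v) w =
  a *: gauduchon_christoffel i p u w + gauduchon_christoffel i p v w.
Proof.
move=> ip a u v w; rewrite /gauduchon_christoffel !christoffel_linearl//.
by rewrite !scalerDr !scalerA ![a * _]mulrC addrACA.
Qed.

Fact gauduchon_linearr i p : chart_image i p -> forall a u v w,
  gauduchon_christoffel i p w (a *: u + v) =
  a *: gauduchon_christoffel i p w u + gauduchon_christoffel i p w v.
Proof.
move=> ip a u v w; rewrite /gauduchon_christoffel !christoffel_linearr//.
by rewrite !scalerDr !scalerA ![a * _]mulrC addrACA.
Qed.

Fact gauduchon_smooth i u v :
  smooth_on (chart_image i) (fun p => gauduchon_christoffel i p u v).
Proof.
apply: smooth_on_lincomb; [exact: image_open| |]; exact: christoffel_smooth.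
Qed.

Fact gauduchon_transition i j p : chart_overlap i j p -> forall u v,
  'd (transition i j) p (gauduchon_christoffel i p u v) =
  'D_u (fun q => 'D_v (transition i j) q) p +
  gauduchon_christoffel j (transition i j p) ('d (transition i j) p u)
                                             ('d (transition i j) p v).
Proof.
move=> ijp u v; rewrite /gauduchon_christoffel linearD !linearZ/=.
rewrite !christoffel_transition// !scalerDr addrACA -scalerDl.
suff -> : (1 + r) / 2 + (1 - r) / 2 = 1 by rewrite scale1r.
by rewrite -mulrDl addrACA subrr addr0 divff// pnatr_eq0.
Qed.

(* D^r = (1 + r)/2 Dc + (1 - r)/2 Ds; the derivative terms add up because the
   coefficients sum to 1. *)
Definition gauduchon : connection M :=
  Connection gauduchon_linearl gauduchon_linearr gauduchon_smooth
    gauduchon_transition.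

End Gauduchon.

(* Main.v *)
Require Import Defs.
From mathcomp Require Import all_boot all_order all_algebra.
From mathcomp Require Import all_classical all_reals all_analysis.
From mathcomp Require Import ring lra.
Set Implicit Arguments.
Unset Strict Implicit.
Unset Printing Implicit Defensive.
Import Order.TTheory GRing.Theory Num.Theory.
Import numFieldNormedType.Exports.
Local Open Scope classical_set_scope.
Local Open Scope ring_scope.

(* With t = (1 - r) / 2 and c = Ds - Dc one has D^r = Dc + t c, and
   c_x = - T_x + T_x^* where T is the Chern torsion (C-bilinear) and T_x^* the
   transpose of T_x. The curvature of D^r is R + t A + t^2 Q, with R the Chern
   curvature, A built from the covariant derivative of T, Q = [c, c]. Two of its
   components are used.

   (1,1): if D^r is Kaehler-like, R^r(e_i, conj e_j) e_k is symmetric in i and k.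
   As R(e_i, conj e_j) e_k - R(e_k, conj e_j) e_i is a derivative of T, this is an
   identity I_t between first derivatives of T and quadratic expressions in T.
   Its full trace reads (4t - 1) d + 2 t^2 (|T|^2 + |h|^2) = 0, where d does not
   depend on t. Two parameters with t + t' != 4tt' therefore give T = 0.

   (0,2): if t + t' = 4tt', then t and t' are nonzero; the (0,2)-components of R,
   R + t A + t^2 Q and R + t' A + t'^2 Q vanish, hence so does that of Q, i.e.
   T_x T_y = T_y T_x. Since T is antisymmetric this forces T(x, T(y, z)) = 0.
   Evaluating on v = T(x, y) the part of I_t symmetric in two of its arguments
   then leaves (2t - 1) Z + 2 t^2 |T_k^* v|^2 = 0, whence T_k^* v = 0 and T = 0. *)

(** * Pointwise algebra *)

Section Bilinear.
Variables (R : realFieldType) (U V W : lmodType R).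

(** A bare predicate, so that it applies at each point of a chart to metrics, Christoffel symbols
    and their derivatives, which are plain functions. *)
Definition bilin (B : U -> V -> W) :=
  (forall v, linear (B^~ v)) /\ (forall u, linear (B u)).

Lemma linearS (f : U -> W) : linear f ->
  [/\ {morph f : u v / u + v}, {morph f : u / - u} &
      forall a, {morph f : u / a *: u}].
Proof.
move=> lf; have f0 : f 0 = 0.
  have := lf 1 0 0; rewrite !scale1r addr0 -[LHS]addr0.
  by move/addrI.
have fD : {morph f : u v / u + v} by move=> u v; have := lf 1 u v; rewrite !scale1r.
have fZ a : {morph f : u / a *: u} by move=> u; have := lf a u 0; rewrite f0 !addr0.
by split=> // u; rewrite -scaleN1r fZ scaleN1r.
Qed.
End Bilinear.

Section BilinearTheory.
Variables (R : realFieldType) (U V W : lmodType R) (B : U -> V -> W).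
Hypothesis hB : bilin B.

Lemma bilinDl v : {morph B^~ v : x y / x + y}.
Proof. by case: (linearS (hB.1 v)). Qed.
Lemma bilinNl v : {morph B^~ v : x / - x}.
Proof. by case: (linearS (hB.1 v)). Qed.
Lemma bilinZl v a : {morph B^~ v : x / a *: x}.
Proof. by case: (linearS (hB.1 v)). Qed.
Lemma bilinDr u : {morph B u : x y / x + y}.
Proof. by case: (linearS (hB.2 u)). Qed.
Lemma bilinNr u : {morph B u : x / - x}.
Proof. by case: (linearS (hB.2 u)). Qed.
Lemma bilinZr u a : {morph B u : x / a *: x}.
Proof. by case: (linearS (hB.2 u)). Qed.
Definition bilinE :=
  (bilinDl, bilinDr, bilinNl, bilinNr, bilinZl, bilinZr).
Lemma bilin0l v : B 0 v = 0.
Proof. by rewrite -(scale0r 0) bilinZl scale0r. Qed.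
Lemma bilin0r u : B u 0 = 0.
Proof. by rewrite -(scale0r 0) bilinZr scale0r. Qed.
Lemma bilin_suml v n (f : 'I_n -> U) : B (\sum_i f i) v = \sum_i B (f i) v.
Proof. exact: (big_morph (B^~ v) (bilinDl v) (bilin0l v)). Qed.
Lemma bilin_sumr u n (f : 'I_n -> V) : B u (\sum_i f i) = \sum_i B u (f i).
Proof. exact: (big_morph (B u) (bilinDr u) (bilin0r u)). Qed.
End BilinearTheory.

Section Pointwise.
Variables (R : realFieldType) (V : lmodType R).
Variables (g : V -> V -> R) (J : V -> V).
Hypothesis g_bilin : @bilin R V V R^o g.
Hypothesis gC : forall u v, g u v = g v u.
Hypothesis g_gt0 : forall u, u != 0 -> 0 < g u u.
Hypothesis gJJ : forall u v, g (J u) (J v) = g u v.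
Hypothesis J_linear : linear J.
Hypothesis JK : forall u, J (J u) = - u.

Let JD u v : J (u + v) = J u + J v.
Proof. by case: (linearS J_linear). Qed.
Let JN u : J (- u) = - J u.
Proof. by case: (linearS J_linear). Qed.
Let gDl u v w : g (u + v) w = g u w + g v w.
Proof. exact: (bilinDl g_bilin). Qed.
Let gDr u v w : g w (u + v) = g w u + g w v.
Proof. exact: (bilinDr g_bilin). Qed.
Let gNl u w : g (- u) w = - g u w.
Proof. exact: (bilinNl g_bilin). Qed.
Let gNr u w : g w (- u) = - g w u.
Proof. exact: (bilinNr g_bilin). Qed.
Let gZl a u w : g (a *: u) w = a * g u w.
Proof. exact: (bilinZl g_bilin). Qed.
Let gZr a u w : g w (a *: u) = a * g w u.
Proof. exact: (bilinZr g_bilin). Qed.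
Let g0 w : g 0 w = 0.
Proof. exact: (bilin0l g_bilin). Qed.
Let gE := (gDl, gDr, gNl, gNr, gZl, gZr).

Lemma g_Jl u v : g (J u) v = - g u (J v).
Proof. by rewrite -(gJJ u) JK gNr opprK. Qed.

Lemma g_ge0 u : 0 <= g u u.
Proof.
have [->|/g_gt0/ltW//] := eqVneq u 0.
by rewrite g0.
Qed.

Lemma g_eq0 u : g u u = 0 -> u = 0.
Proof. by move=> u0; apply/eqP/negP => /negP /g_gt0; rewrite u0 ltxx. Qed.

Lemma g_inj u v : (forall w, g u w = g v w) -> u = v.
Proof.
move=> uv; apply/eqP; rewrite -subr_eq0; apply/eqP/g_eq0.
by rewrite gDl gNl uv subrr.
Qed.

(** * Algebraic consequences of the torsion identity *)

Section Torsion.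
Variable T : V -> V -> V.
Hypothesis T_bilin : bilin T.
Hypothesis TC : forall x y, T y x = - T x y.
Hypothesis TJl : forall x y, T (J x) y = J (T x y).

Lemma TJr x y : T x (J y) = J (T x y).
Proof. by rewrite TC TJl (TC x y) JN opprK. Qed.

(** With [T] the Chern torsion and [c] the difference Ds - Dc, the hypotheses are DJ = 0, Dg = 0 and
    skewness of the torsion for Ds; they determine [c] from [T] alone. *)
Lemma strominger_formula (c : V -> V -> V) :
  (forall x y, c x (J y) = J (c x y)) ->
  (forall x y z, g (c x y) z = - g y (c x z)) ->
  (forall x y z, g (T x z + c x z - c z x) y = - g (T x y + c x y - c y x) z) ->
  forall x y z, g (c x y) z = - g (T x y) z + g y (T x z).
Proof.
move=> cJ cskew tskew.
(* The defect f is a 3-form with f x (J y) z = - f x y (J z); moving J around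
   the three arguments changes the sign three times, so f vanishes. *)
pose f x y z := g (c x y) z + g (T x y) z - g y (T x z).
have fskew x y z : f x z y = - f x y z.
  rewrite /f cskew !(gC z) (gC (c x y)).
  have := cskew x y z; rewrite (gC (T x z)); lra.
have fcyc x y z : f z x y = f y z x.
  have := tskew x y z; have := fskew x y z; have := fskew y x z.
  rewrite /f !gE (TC x z) (TC x y) (TC y z) !gE.
  have := cskew z x y; have := cskew y z x; have := cskew y x z.
  rewrite !(gC x) !(gC y) !(gC z).
  lra.
have fJ x y z : f x (J y) z = - f x y (J z).
  rewrite /f cJ !TJr !g_Jl; lra.
have f0 x y z : f x y (J z) = 0.
  have := fJ x y z; have := fJ y z x; have := fJ z x y.
  have := fcyc (J y) z x; have := fcyc y (J z) x; have := fcyc y z (J x).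
  have := fcyc z x (J y); have := fcyc z (J x) y; have := fcyc (J z) x y.
  lra.
move=> x y z.
have := f0 x (J y) z; rewrite fJ JK /f !gNr !(bilinNr T_bilin) !gNr; lra.
Qed.

Variables (P : V -> V -> V) (ub : V -> V -> V -> V -> R).
Hypothesis g_P : forall x y z, g (P x y) z = g y (T x z).
Hypothesis ubC : forall y x z w, ub y z x w = - ub y x z w.

(** The identity I_t: half of the antisymmetrisation in [x] and [z] of the (1,1)-part of the
    curvature. [P x] is the transpose of [T x], and [ub y] will be the antilinear derivative of [T]
    along [y]. *)
Definition torsion_identity t := forall x y z w,
  - ub y x z w + t * (ub x y w z - ub z y w x + 2 * ub y x z w) +
  2 * t ^+ 2 * (g (P y x) (P z w) - g (P y z) (P x w) + 2 * g (T x z) (T y w))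
  = 0.

Section Trace.
Variables (m : nat) (e : 'I_m -> V).
Hypothesis parseval : forall u v, g u v = \sum_a g u (e a) * g (e a) v.

Let sumT := \sum_a \sum_b g (T (e a) (e b)) (T (e a) (e b)).
Let h := \sum_a P (e a) (e a).

Lemma frame_torsion_eq0 : sumT = 0 -> forall x y, T x y = 0.
Proof.
move=> T0; have Tee a b : T (e a) (e b) = 0.
  apply: g_eq0; move: T0 => /eqP; rewrite psumr_eq0; last first.
    by move=> i _; apply: sumr_ge0 => j _; exact: g_ge0.
  move=> /allP/(_ a); rewrite mem_index_enum => /(_ isT)/= /eqP/eqP.
  rewrite psumr_eq0; last by move=> j _; exact: g_ge0.
  by move=> /allP/(_ b); rewrite mem_index_enum => /(_ isT)/= /eqP.
(* In the frame, the components of [P z w] are the products of [w] with the [T z (e b)]. *)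
have Tz z : (forall b, T z (e b) = 0) -> forall y, T z y = 0.
  move=> zb y; apply: g_inj => w; rewrite gC -g_P parseval g0.
  by rewrite big1// => b _; rewrite g_P zb gC g0 mul0r.
have Te a y : T (e a) y = 0 by apply: Tz => b.
by move=> x y; apply: Tz => b; rewrite TC Te oppr0.
Qed.

(** Transposition preserves the Hilbert-Schmidt norm, here applied to each [T (e a)]. *)
Lemma sum_P : \sum_a \sum_b g (P (e a) (e b)) (P (e a) (e b)) = sumT.
Proof.
apply: eq_bigr => a _.
under eq_bigr do rewrite parseval.
under [RHS]eq_bigr do rewrite parseval.
rewrite exchange_big; apply: eq_bigr => b _; apply: eq_bigr => c _.
by rewrite !g_P !(gC (e _)) g_P (gC (e _)).
Qed.

(** Contract [x] with [y] and [z] with [w]. By antisymmetry the terms in [t] contribute 1 + 1 + 2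
    copies of the same trace of [ub]; the quadratic terms give |h|^2 - |P|^2 + 2|T|^2, and |P| =
    |T|. *)
Lemma trace_torsion_identity t : torsion_identity t ->
  (4 * t - 1) * (\sum_a \sum_b ub (e a) (e a) (e b) (e b))
  + 2 * t ^+ 2 * (sumT + g h h) = 0.
Proof.
move=> It.
have gh : g h h = \sum_a \sum_b g (P (e a) (e a)) (P (e b) (e b)).
  rewrite {1}/h (bilin_suml g_bilin); apply: eq_bigr => a _.
  by rewrite (bilin_sumr g_bilin).
have tr : \sum_a \sum_b ub (e b) (e a) (e b) (e a) =
    - \sum_a \sum_b ub (e a) (e a) (e b) (e b).
  rewrite exchange_big -sumrN; apply: eq_bigr => a _; rewrite -sumrN.
  by apply: eq_bigr => b _; rewrite ubC.
have : \sum_a \sum_b (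
  - ub (e a) (e a) (e b) (e b) + t * (ub (e a) (e a) (e b) (e b)
    - ub (e b) (e a) (e b) (e a) + 2 * ub (e a) (e a) (e b) (e b)) +
  2 * t ^+ 2 * (g (P (e a) (e a)) (P (e b) (e b))
    - g (P (e a) (e b)) (P (e a) (e b))
    + 2 * g (T (e a) (e b)) (T (e a) (e b)))) = 0.
  by rewrite big1// => a _; rewrite big1// => b _; exact: It.
under eq_bigr do rewrite !(big_split, sumrN, =^~ mulr_sumr)/=.
rewrite !(big_split, sumrN, =^~ mulr_sumr)/= tr sum_P -gh -/sumT.
by move=> H; apply: (etrans _ H); ring.
Qed.

Lemma torsion_eq0_generic t t' : t != t' -> t + t' != 4 * t * t' ->
  torsion_identity t -> torsion_identity t' -> forall x y, T x y = 0.
Proof.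
move=> tt' ntt' /trace_torsion_identity It /trace_torsion_identity It'.
apply: frame_torsion_eq0.
move: It It'; set d := \sum_a _; set X := sumT + _ => It It'.
(* Eliminate the trace [d] of the derivative between the two traced identities. *)
have : (t - t') * (t + t' - 4 * t * t') * X = 0.
  have -> : (t - t') * (t + t' - 4 * t * t') * X =
    2^-1 * ((4 * t - 1) * ((4 * t' - 1) * d + 2 * t' ^+ 2 * X)
      - (4 * t' - 1) * ((4 * t - 1) * d + 2 * t ^+ 2 * X)) by field.
  by rewrite It It'; ring.
move/eqP; rewrite !mulf_eq0 !subr_eq0 (negbTE tt') (negbTE ntt') /= /X.
rewrite paddr_eq0 ?g_ge0//; first by move=> /andP[/eqP].
by do 2![apply: sumr_ge0 => ? _]; exact: g_ge0.
Qed.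
End Trace.

Lemma torsion_eq0_nilpotent t t' : t != t' -> t + t' != 2 * t * t' ->
  (forall x y z, T x (T y z) = 0) ->
  torsion_identity t -> torsion_identity t' -> forall x y, T x y = 0.
Proof.
move=> tt' ntt' TT It It' p q; set v := T p q.
have Tv y : T v y = 0 by rewrite TC TT oppr0.
have Pv y : P v y = 0 by apply: g_inj => w; rewrite g_P Tv gC !g0.
have Pkv k s : torsion_identity s ->
    (2 * s - 1) * (ub v v k k + ub k v k v) + 2 * s ^+ 2 * g (P k v) (P k v) = 0.
  (* In the sum of these two instances every quadratic term but |P k v|^2 contains [T v] or [P v],
     and the derivatives combine into a multiple of one sum, which is eliminated below between [t]
     and [t']. *)
  move=> Is; have := Is v k k v; have := Is v v k k.
  rewrite !Pv !Tv !(gC _ 0) !g0 (ubC v v k) (ubC k v k); lra.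
(* |v|^2 = g(v, T p q) = g(P p v, q). *)
apply: g_eq0; rewrite -[g v v]/(g v (T p q)) -g_P.
suff -> : P p v = 0 by rewrite g0.
apply: g_eq0.
have := Pkv p t It; have := Pkv p t' It'.
set Z := ub _ _ _ _ + _; set X := g _ _ => eq' eq.
have : (t - t') * (t + t' - 2 * t * t') * X = 0.
  have -> : (t - t') * (t + t' - 2 * t * t') * X =
    2^-1 * ((2 * t - 1) * ((2 * t' - 1) * Z + 2 * t' ^+ 2 * X)
      - (2 * t' - 1) * ((2 * t - 1) * Z + 2 * t ^+ 2 * X)) by field.
  by rewrite eq eq'; ring.
by move/eqP; rewrite !mulf_eq0 !subr_eq0 (negbTE tt') (negbTE ntt') => /eqP.
Qed.
End Torsion.

(** * Curvature of Dc + t c at a point and its type components *)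

(* C, c and dC, dc stand for the Christoffel symbols of the Chern connection, the
   difference tensor Ds - Dc, and their derivatives in a chart: dC u x y is the
   derivative of C x y in the direction u. *)
Section Curvature.
Variables (C c : V -> V -> V) (dC dc : V -> V -> V -> V).
Hypothesis C_bilin : bilin C.
Hypothesis c_bilin : bilin c.
Hypothesis dC_bilin : forall u, bilin (dC u).
Hypothesis dC_linear : forall x y, linear (fun u => dC u x y).
Hypothesis dc_bilin : forall u, bilin (dc u).
Hypothesis dc_linear : forall x y, linear (fun u => dc u x y).
Hypothesis CJl : forall x y, C (J x) y = J (C x y).
Hypothesis CJr : forall x y, C x (J y) = J (C x y).
Hypothesis cJr : forall x y, c x (J y) = J (c x y).
Hypothesis dCJl : forall u x y, dC u (J x) y = J (dC u x y).
Hypothesis dCJr : forall u x y, dC u x (J y) = J (dC u x y).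
Hypothesis dcJr : forall u x y, dc u x (J y) = J (dc u x y).

Let T x y := C x y - C y x.
Let dT u x y := dC u x y - dC u y x.
(* The covariant derivative of T in the direction u. *)
Let U u x y := dT u x y + C u (T x y) - T (C u x) y - T x (C u y).

Hypothesis cE : forall x y z, g (c x y) z = - g (T x y) z + g y (T x z).
(* The derivative of cE along u, that of the metric being given by C. *)
Hypothesis dcE : forall u x y z,
  g (dc u x y) z + (g (C u (c x y)) z + g (c x y) (C u z)) =
  - (g (dT u x y) z + (g (C u (T x y)) z + g (T x y) (C u z))) +
  (g y (dT u x z) + (g (C u y) (T x z) + g y (C u (T x z)))).

Definition curv (G : V -> V -> V) (dG : V -> V -> V -> V) x y z :=
  dG x y z - dG y x z + G x (G y z) - G y (G x z).
Let Rm t := curv (fun x y => C x y + t *: c x y)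
                 (fun u x y => dC u x y + t *: dc u x y).

Let A x y z := dc x y z - dc y x z + C x (c y z) + c x (C y z)
  - C y (c x z) - c y (C x z).

Lemma curvE t x y z : Rm t x y z =
  curv C dC x y z + t *: A x y z + t ^+ 2 *: (c x (c y z) - c y (c x z)).
Proof.
apply: g_inj => w; rewrite /Rm /curv /A.
rewrite !(bilinE C_bilin, bilinE c_bilin) !gE; ring.
Qed.

(** [A x y z] is the covariant derivative of [c] antisymmetrised in [x], [y], plus [c (T x y) z].
    Since the metric is parallel, substituting the formula for [c] turns the former into derivatives
    [U] of [T]. *)
Lemma g_A x y z w : g (A x y z) w =
  - g (U x y z) w + g z (U x y w) + g (U y x z) w - g z (U y x w)
  - g (T (T x y) z) w + g z (T (T x y) w).
Proof.
have := dcE x y z w; have := dcE y x z w.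
rewrite /A /U /dT !gE !cE /T !(bilinE C_bilin) !gE.
by rewrite ?(gC z) ?(gC w); lra.
Qed.

Let TC x y : T y x = - T x y.
Proof. by rewrite /T opprB. Qed.
Let TJl x y : T (J x) y = J (T x y).
Proof. by rewrite /T CJl CJr JD JN. Qed.
Let TJr x y : T x (J y) = J (T x y).
Proof. by rewrite /T CJl CJr JD JN. Qed.

Let T_bilin : bilin T.
Proof.
by split=> u a x y; apply: g_inj => w;
  rewrite /T !(bilinE C_bilin) !gE; ring.
Qed.

Let dCJuN x y z : dC (- x) y z = - dC x y z.
Proof. by case: (linearS (dC_linear y z)). Qed.

Let UC u x y : U u y x = - U u x y.
Proof.
apply: g_inj => w; rewrite /U /dT /T !(bilinE C_bilin) !gE; ring.
Qed.

Let UJl u x y : U u (J x) y = J (U u x y).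
Proof. by rewrite /U /dT !(dCJl, dCJr, CJr, TJl, JD, JN). Qed.

Let UJr u x y : U u x (J y) = J (U u x y).
Proof. by rewrite UC UJl (UC u x) JN opprK. Qed.

Let UNl u x y : U (- u) x y = - U u x y.
Proof.
apply: g_inj => w; rewrite /U /dT /T !dCJuN !(bilinE C_bilin) !gE; ring.
Qed.

(* Up to a factor 4, the components of F on (e_i, conj e_j, e_k) and on
   (conj e_i, conj e_j, e_k), w being dual to a vector-valued F x y z. *)
Definition proj11 (F : V -> V -> V -> V -> R) x y z w :=
  F x y z w + F (J x) y z (J w) - F x (J y) z (J w) + F (J x) (J y) z w.
Definition proj02 (F : V -> V -> V -> V -> R) x y z w :=
  F x y z w - F (J x) y z (J w) - F x (J y) z (J w) - F (J x) (J y) z w.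

(* Twice the part of U that is antilinear in u. *)
Let ub u x y w := g (U u x y) w - g (U (J u) x y) (J w).

(** The first Bianchi identity with torsion. Terms complex linear in [y] drop out of the (1,1)-part,
    which leaves the antilinear derivative of [C] along [y]; its antisymmetrisation in [x], [z] is
    that of [T]. *)
Lemma proj11_chern x y z w :
  proj11 (fun x y z => g (curv C dC x y z)) x y z w
  - proj11 (fun x y z => g (curv C dC x y z)) z y x w = - 2 * ub y x z w.
Proof.
rewrite /proj11 /ub /U /dT /T /curv.
rewrite !(CJl, CJr, dCJl, dCJr, JD, JN, JK) !(bilinE C_bilin) !gE.
rewrite !(JD, JN) !gE !gJJ !g_Jl ?JK ?gE; lra.
Qed.

(** Every term of the Chern curvature is complex linear in [x] or in [y]. *)
Lemma proj02_chern x y z w :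
  proj02 (fun x y z => g (curv C dC x y z)) x y z w = 0.
Proof.
rewrite /proj02 /curv !(CJl, CJr, dCJl, dCJr, JD, JN, JK) !gE.
rewrite ?gJJ ?g_Jl ?(JK, gE); lra.
Qed.

(** Transposition exchanges linear and antilinear dependence. Hence only the terms [g z (U x y w)]
    and [g (U y x z) w] of [g_A] can be linear in [x] and antilinear in [y]. *)
Lemma proj11_A x y z w :
  proj11 (fun x y z => g (A x y z)) x y z w = 2 * (ub x y w z + ub y x z w).
Proof.
rewrite /proj11 /ub !g_A !(TJl, TJr, UJl, UJr, JD, JN, JK).
rewrite ?g_Jl !(JK, UNl, gE) ?(gC z) ?(gC (J z)) ?g_Jl !(JK, gE); lra.
Qed.

(* The transpose of T x. *)
Let P x y := c x y + T x y.

Let g_P x y z : g (P x y) z = g y (T x z).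
Proof. by rewrite /P gDl cE; lra. Qed.
Let PJr x y : P x (J y) = J (P x y).
Proof. by rewrite /P cJr TJr JD. Qed.
Let PJl x y : P (J x) y = - J (P x y).
Proof.
by apply: g_inj => z; rewrite -PJr gNl !g_P TJl g_Jl opprK.
Qed.
Let cPT x y : c x y = P x y - T x y.
Proof. by rewrite /P addrK. Qed.

Let Q x y z := c x (c y z) - c y (c x z).

Let c_skew x y z : g (c x y) z = - g y (c x z).
Proof. rewrite (gC y) !cE (gC z) (gC y); lra. Qed.

Lemma g_Q x y z w : g (Q x y z) w = - g (c y z) (c x w) + g (c x z) (c y w).
Proof.
by rewrite /Q gDl gNl (c_skew x (c y z)) (c_skew y (c x z)) opprK.
Qed.

(** [T] is complex linear and [P] antilinear in the first argument, so in the commutator of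
    [P x - T x] and [P y - T y] only that of [P y] and [T x] survives. *)
Lemma proj11_Q x y z w :
  proj11 (fun x y z => g (Q x y z)) x y z w =
  4 * (- g (P y z) (P x w) + g (T x z) (T y w)).
Proof.
rewrite /proj11 !g_Q !cPT; clearbody P T.
rewrite !(PJl, PJr, TJl, TJr, gE, JN, JK).
rewrite !(g_Jl, JK, gE); lra.
Qed.

(** What survives is the commutator of [P x] and [P y], the transpose of that of [T y] and [T x]. *)
Lemma proj02_Q x y z w :
  proj02 (fun x y z => g (Q x y z)) x y z w =
  4 * (g z (T y (T x w)) - g z (T x (T y w))).
Proof.
rewrite /proj02 !g_Q !cPT; clearbody P T.
rewrite !(PJl, PJr, TJl, TJr, gE, JN, JK).
rewrite !(g_Jl, JK, gE) -!(g_P _ z); lra.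
Qed.

Definition bianchi_like (K : V -> V -> V -> V) := forall x y z w,
  g (K x y z) w + g (K y z x) w + g (K z x y) w = 0 /\
  g (K (J x) (J y) z) w = g (K x y z) w.

(** * Consequences of the Kähler-like condition for one parameter *)

Section KahlerLike.
Variable t : R.
Hypothesis kl : bianchi_like (Rm t).
Let F x y z w := g (Rm t x y z) w.

Let F_Jxy x y z w : F (J x) (J y) z w = F x y z w.
Proof. by case: (kl x y z w). Qed.

Let F_xJy x y z w : F x (J y) z w = - F (J x) y z w.
Proof.
rewrite -F_Jxy JK /F /Rm /curv.
have dcuN u v : dc (- y) u v = - dc y u v by case: (linearS (dc_linear u v)).
by rewrite !dCJuN !dcuN !(bilinE (dC_bilin _), bilinE (dc_bilin _),
  bilinE C_bilin, bilinE c_bilin) !gE; ring.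
Qed.

Let F_xy x y z w : F y x z w = - F x y z w.
Proof. by rewrite /F /Rm /curv !gE; ring. Qed.

Let F_Jz x y z w : F x y (J z) w = - F x y z (J w).
Proof.
rewrite /F /Rm /curv !(dCJr, dcJr, CJr, cJr, bilinE C_bilin, bilinE c_bilin).
rewrite !(gE, g_Jl, dCJr, dcJr, CJr, cJr); ring.
Qed.

(** The cyclic term [F z x y w] does not change when [J] is applied to both [y] and [w]. Subtracting
    the Bianchi identity at [J y], [J w] from that at [y], [w] therefore cancels it. *)
Lemma kl_proj11 x y z w : proj11 F x y z w = proj11 F z y x w.
Proof.
have [+ _] := kl x y z w; have [+ _] := kl x (J y) z (J w).
rewrite -!/(F _ _ _ _) /proj11 !F_Jxy.
rewrite (F_Jz z x) (F_xy z (J y)) (F_xy z y) JK !F_xJy /F gNr; lra.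
Qed.

Lemma kl_proj02 x y z w : proj02 F x y z w = 0.
Proof. by rewrite /proj02 F_Jxy F_xJy; lra. Qed.

Lemma proj11_curv x y z w : proj11 F x y z w =
  proj11 (fun x y z => g (curv C dC x y z)) x y z w +
  t * proj11 (fun x y z => g (A x y z)) x y z w +
  t ^+ 2 * proj11 (fun x y z => g (Q x y z)) x y z w.
Proof. by rewrite /proj11 /F !curvE !gE /Q; ring. Qed.

Lemma proj02_curv x y z w : proj02 F x y z w =
  proj02 (fun x y z => g (curv C dC x y z)) x y z w +
  t * proj02 (fun x y z => g (A x y z)) x y z w +
  t ^+ 2 * proj02 (fun x y z => g (Q x y z)) x y z w.
Proof. by rewrite /proj02 /F !curvE !gE /Q; ring. Qed.

Lemma kl_torsion_identity : torsion_identity T P ub t.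
Proof.
move=> x y z w; have := kl_proj11 x y z w; rewrite !proj11_curv !proj11_A !proj11_Q.
have := proj11_chern x y z w.
have -> : ub y z x w = - ub y x z w by rewrite /ub !(UC _ x z) !gNl; lra.
rewrite (TC x z) gNl.
lra.
Qed.
End KahlerLike.

Lemma kl_torsion_nilpotent t t' : t != t' -> t != 0 -> t' != 0 ->
  bianchi_like (Rm t) -> bianchi_like (Rm t') -> forall x y z, T x (T y z) = 0.
Proof.
move=> tt' t0 t'0 kl kl'.
have Tsym x y z : T x (T y z) = T y (T x z).
  apply: g_inj => w; rewrite gC (gC (T y _)).
  have := kl_proj02 kl x y w z; have := kl_proj02 kl' x y w z.
  rewrite !proj02_curv !proj02_chern !proj02_Q.
  set a := proj02 _ _ _ _ _; set X := g w _; set Y := g w _ => e' e.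
  (* Eliminate [a], the part linear in the parameter, between the two vanishing (0,2)-components. *)
  have : t * t' * (t - t') * (X - Y) = 0.
    have -> : t * t' * (t - t') * (X - Y) = 4^-1 *
      (t' * (0 + t * a + t ^+ 2 * (4 * (X - Y))) -
       t * (0 + t' * a + t' ^+ 2 * (4 * (X - Y)))) by field.
    by rewrite e e' !mulr0 subrr mulr0.
  move/eqP; rewrite !mulf_eq0 (negbTE t0) (negbTE t'0) !subr_eq0 (negbTE tt').
  by move=> /eqP/esym.
(* [T x (T y z)] is symmetric in its first two arguments and antisymmetric in its last two;
   alternating the two exchanges returns to the start with opposite sign. *)
move=> x y z; apply: g_inj => w.
have Tskew u v k : g (T u (T v k)) w = - g (T u (T k v)) w.
  by rewrite (TC k v) (bilinNr T_bilin) gNl.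
have Tsymw u v k : g (T u (T v k)) w = g (T v (T u k)) w by rewrite Tsym.
rewrite g0.
have := Tskew x y z; have := Tskew y z x; have := Tskew z x y.
have := Tsymw x y z; have := Tsymw y z x; have := Tsymw z x y.
lra.
Qed.

Lemma bianchi_like_torsion_eq0 m (e : 'I_m -> V) t t' :
  (forall u v, g u v = \sum_a g u (e a) * g (e a) v) ->
  t != t' -> bianchi_like (Rm t) -> bianchi_like (Rm t') ->
  forall x y, C x y = C y x.
Proof.
move=> pe tt' kl kl'.
suff T0 x y : T x y = 0 by move=> x y; apply/eqP; rewrite -subr_eq0 -/(T x y) T0.
have It := kl_torsion_identity kl; have It' := kl_torsion_identity kl'.
have ubC u v k w : ub u k v w = - ub u v k w.
  by rewrite /ub !(UC _ v k) !gNl opprD.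
have [e4|] := eqVneq (t + t') (4 * t * t'); last first.
  by move=> ne; exact: (torsion_eq0_generic TC g_P ubC pe tt' ne It It').
have t0 : t != 0.
  by apply: contra_neq tt' => t0; move: e4; rewrite t0; lra.
have t'0 : t' != 0.
  by apply: contra_neq tt' => t'0; move: e4; rewrite t'0; lra.
apply: (torsion_eq0_nilpotent TC g_P ubC tt' _ _ It It').
  (* Here t + t' - 2tt' = 2tt', which is nonzero. *)
  by rewrite e4 -subr_eq0 -!mulrBl !mulf_neq0// subr_eq0 eqr_nat.
exact: kl_torsion_nilpotent tt' t0 t'0 kl kl'.
Qed.
End Curvature.
End Pointwise.

(** * Orthonormal frames and derivatives in a chart *)

Section Frame.
Variables (R : rcfType) (m : nat) (g : 'rV[R]_m -> 'rV[R]_m -> R).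
Hypothesis g_bilin : @bilin R _ _ R^o g.
Hypothesis gC : forall u v, g u v = g v u.
Hypothesis g_gt0 : forall u, u != 0 -> 0 < g u u.

Let gZl a u w : g (a *: u) w = a * g u w.
Proof. exact: (bilinZl g_bilin). Qed.
Let gZr a u w : g w (a *: u) = a * g w u.
Proof. exact: (bilinZr g_bilin). Qed.

Let G : 'M[R]_m := \matrix_(i, j) g (delta_mx 0 i) (delta_mx 0 j).

Let gG u v : g u v = (u *m G *m v^T) 0 0.
Proof.
rewrite {1}(row_sum_delta u) {1}(row_sum_delta v) (bilin_suml g_bilin) mxE.
under [RHS]eq_bigr do rewrite !mxE big_distrl/=.
rewrite exchange_big; apply: eq_bigr => i _ /=.
rewrite gZl (bilin_sumr g_bilin) mulr_sumr.
apply: eq_bigr => j _; rewrite gZr !mxE; ring.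
Qed.

(** Gram-Schmidt: [G *m A^T] has fewer columns than rows, so its left kernel contains a nonzero
    vector, orthogonal to the rows of [A], which is then normalised. *)
Lemma orthonormal_rows k : (k <= m)%N ->
  exists A : 'M[R]_(k, m), A *m G *m A^T = 1%:M.
Proof.
elim: k => [_|k IH km]; first by exists 0; apply/matrixP => -[].
have [A AG] := IH (ltnW km).
have [v v0 vA] : exists2 v : 'rV[R]_m, v != 0 & v *m (G *m A^T) = 0.
  have : kermx (G *m A^T) != 0.
    rewrite kermx_eq0 /row_free neq_ltn; apply/orP; left.
    exact: leq_ltn_trans (rank_leq_col _) km.
  move=> /rowV0Pn[v /sub_kermxP vA v0]; by exists v.
have GT : G^T = G by apply/matrixP => i j; rewrite !mxE gC.
pose w := (Num.sqrt (g v v))^-1 *: v.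
have wA : w *m G *m A^T = 0 by rewrite -mulmxA -scalemxAl vA scaler0.
have Aw : A *m G *m w^T = 0.
  by apply: trmx_inj; rewrite !trmx_mul trmxK GT mulmxA wA trmx0.
have ww : w *m G *m w^T = 1%:M.
  rewrite [LHS]mx11_scalar -gG /w gZl gZr.
  congr (_%:M); have v_gt0 := g_gt0 v0.
  rewrite mulrA -invfM -expr2 sqr_sqrtr ?ltW// mulVf//.
  by rewrite gt_eqF.
have : exists A' : 'M[R]_(k + 1, m), A' *m G *m A'^T = 1%:M.
  exists (col_mx A w); rewrite tr_col_mx !mul_col_mx !mul_mx_row AG Aw wA ww.
  by rewrite -block_mxEv -scalar_mx_block.
by rewrite addn1.
Qed.

(** For square [A] the factors of [A *m G *m A^T = 1] may be permuted cyclically, and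
    [G *m A^T *m A = 1] is Parseval's formula. *)
Lemma parseval_frame : exists e : 'I_m -> 'rV[R]_m,
  forall u v, g u v = \sum_a g u (e a) * g (e a) v.
Proof.
have [A AG] := orthonormal_rows (leqnn m).
have AG' : G *m A^T *m A = 1%:M by apply: mulmx1C; rewrite mulmxA.
exists (fun a => row a A) => u v.
have gl a : g u (row a A) = (u *m G *m A^T) 0 a.
  by rewrite gG tr_row !mxE; apply: eq_bigr => i _; rewrite !mxE.
have gr a : g (row a A) v = (A *m G *m v^T) a 0.
  by rewrite gG -!row_mul mxE.
under eq_bigr do rewrite gl gr.
transitivity ((u *m G *m A^T *m (A *m G *m v^T)) 0 0); last by rewrite mxE.
rewrite gG (_ : _ *m (A *m G *m v^T) = u *m (G *m A^T *m A) *m (G *m v^T)).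
  by rewrite AG' mulmx1 mulmxA.
by rewrite !mulmxA.
Qed.
End Frame.

Section Derivatives.
Variables (R : realType) (V : normedModType R).

Lemma is_derive_entry m n (F : V -> 'M[R]_(m, n)) p u i j : derivable F p u ->
  is_derive p u (fun q => F q i j : R^o) ('D_u F p i j).
Proof.
move=> dF; apply: DeriveDef; first exact: (derivable_mxP F p u).1 dF i j.
by rewrite (derive_mx dF) mxE.
Qed.

Lemma is_derive_lincomb m (F : V -> 'rV[R]_m) (h : 'I_m -> V -> R^o) p u :
  derivable F p u -> (forall k, derivable (h k) p u) ->
  is_derive p u (fun q => \sum_k F q 0 k * h k q : R^o)
    (\sum_k ('D_u F p 0 k * h k p + F p 0 k * 'D_u (h k) p)).
Proof.
move=> dF dh.
have -> : (fun q => \sum_k F q 0 k * h k q : R^o) =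
    \sum_k ((fun q => F q 0 k : R^o) * h k).
  by apply/funext => q; rewrite fct_sumE.
apply: is_derive_eq.
  apply: is_derive_sum => k; apply: is_deriveM.
    exact: is_derive_entry.
  exact: derivableP.
by apply: eq_bigr => k _; rewrite addrC; congr (_ + _); exact: mulrC.
Qed.

Lemma derive_linear m n (L : 'rV[R]_m -> 'rV[R]_n) (F : V -> 'rV[R]_m) p u :
  linear L -> derivable F p u -> 'D_u (fun q => L (F q)) p = L ('D_u F p).
Proof.
move=> lL dF; have [LD _ LZ] := linearS lL.
have L0 : L 0 = 0 by rewrite -(scale0r 0) LZ scale0r.
have LE v j : L v 0 j = \sum_k v 0 k * L (delta_mx 0 k) 0 j.
  rewrite {1}(row_sum_delta v) (big_morph L LD L0) summxE.
  by apply: eq_bigr => k _; rewrite LZ mxE.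
have dL j : is_derive p u (fun q => L (F q) 0 j : R^o) (L ('D_u F p) 0 j).
  under eq_fun do rewrite LE.
  apply: is_derive_eq.
    by apply: is_derive_lincomb => // k; exact: derivable_cst.
  by rewrite LE; apply: eq_bigr => k _; rewrite derive_cst mulr0 addr0.
rewrite derive_mx; last first.
  by apply/derivable_mxP => i j; rewrite ord1; have [] := dL j.
apply/rowP => j; rewrite mxE; have [_ <-] := dL j; by [].
Qed.
End Derivatives.

(** * Torsion and curvature in terms of Christoffel symbols *)

Section LocalComputation.
Variables (R : realType) (n : nat).
Local Notation V := 'rV[R]_(n + n).

Lemma J0_linear : linear (@J0 R n).
Proof.
move=> a u v; apply/rowP => j.
by rewrite !mxE; case: fintype.split => k; rewrite !mxE; ring.
Qed.

Lemma J0K (u : V) : J0 (J0 u) = - u.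
Proof.
by rewrite /J0 row_mxKl row_mxKr -[in RHS](hsubmxK u) opp_row_mx.
Qed.

Lemma bilin_derive (A : set V) (F : V -> V -> V -> V) p u : open A -> A p ->
  (forall q, A q -> bilin (F q)) ->
  (forall x y, differentiable (fun q => F q x y) p) ->
  bilin (fun x y => 'D_u (fun q => F q x y) p).
Proof.
move=> oA Ap bF dF.
have nA : \forall q \near p, A q by exact: open_nbhs_nbhs.
have dv x y : derivable (fun q => F q x y) p u by exact: diff_derivable.
split=> [w a x y|w a x y].
  rewrite (@near_eq_derive _ _ _ _ (a *: (fun q => F q x w) + (fun q => F q y w))).
    by rewrite deriveD ?deriveZ//; exact: derivableZ.
  near=> q; apply: (bF q _).1; near: q; exact: nA.
rewrite (@near_eq_derive _ _ _ _ (a *: (fun q => F q w x) + (fun q => F q w y))).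
  by rewrite deriveD ?deriveZ//; exact: derivableZ.
near=> q; apply: (bF q _).2; near: q; exact: nA.
Unshelve. all: by end_near. Qed.

Lemma derive_direction_linear (F : V -> V) p : differentiable F p ->
  linear (fun u => 'D_u F p).
Proof. by move=> dF a u v; rewrite !deriveE// linearP. Qed.

Variable M : complexManifold R n.
Implicit Types D : connection M.

Lemma cov_cst D i x y q : cov D i (cst x) (cst y) q = christoffel D i q x y.
Proof. by rewrite /cov derive_cst add0r. Qed.

Lemma torsion_atE D i p x y :
  torsion_at D i p x y = christoffel D i p x y - christoffel D i p y x.
Proof.
by rewrite /torsion_at /torsion !cov_cst /lie_bracket !derive_cst subrr subr0.
Qed.

Lemma christoffel_bilin D i p : chart_image i p -> bilin (christoffel D i p).
Proof.
move=> ip; split=> v a x y.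
  exact: christoffel_linearl.
exact: christoffel_linearr.
Qed.

Lemma curvature_atE D i p x y z : chart_image i p ->
  curvature_at D i p x y z =
  curv (christoffel D i p)
    (fun u a b => 'D_u (fun q => christoffel D i q a b) p) x y z.
Proof.
move=> ip; rewrite /curvature_at /curvature /curv.
have e a b : cov D i (cst a) (cst b) = fun q => christoffel D i q a b.
  by apply/funext => q; rewrite cov_cst.
have -> : lie_bracket (cst x) (cst y) = cst 0.
  by apply/funext => q; rewrite /lie_bracket !derive_cst subrr.
rewrite cov_cst (bilin0l (christoffel_bilin D ip)) subr0 !e /cov /=.
by rewrite opprD addrACA !addrA.
Qed.
End LocalComputation.

(** * The Chern and Strominger connections in a chart *)

Section Hermitian.
Variables (R : realType) (n : nat) (M : hermitianManifold R n).
Local Notation V := 'rV[R]_(n + n).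
Variable i : chart_index M.

Let chart_nbhs p : chart_image i p -> \forall q \near p, chart_image i q.
Proof. by move=> ip; apply: open_nbhs_nbhs; split=> //; exact: image_open. Qed.

Lemma metric_bilin p : chart_image i p -> @bilin R V V R^o (metric i p).
Proof.
move=> ip; split=> w a u v; first exact: metric_linear.
by rewrite Defs.metric_sym// metric_linear// !(Defs.metric_sym ip w).
Qed.

(** The Leibniz rule, with the derivative of the metric replaced by Christoffel terms. Expanding [F]
    in the standard basis reduces it to constant fields, where [metric_parallel] applies. *)
Lemma is_derive_metric (D : connection M) (F : V -> V) p u z :
  metric_parallel D -> chart_image i p -> derivable F p u ->
  is_derive p u (fun q => metric i q (F q) z : R^o)
    (metric i p ('D_u F p) z + (metric i p (christoffel D i p u (F p)) z
      + metric i p (F p) (christoffel D i p u z))).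
Proof.
move=> gD ip dF.
have gE q v w : chart_image i q ->
    metric i q v w = \sum_k v 0 k * metric i q (delta_mx 0 k) w.
  move=> iq; rewrite {1}(row_sum_delta v) (bilin_suml (metric_bilin iq)).
  by apply: eq_bigr => k _; rewrite (bilinZl (metric_bilin iq)).
have dg k : derivable (fun q => metric i q (delta_mx 0 k) z : R^o) p u.
  by apply: diff_derivable; exact: (@metric_smooth _ _ M i _ _ [::] p ip).
apply: (@near_eq_is_derive _ _ _
  (fun q => \sum_k F q 0 k * metric i q (delta_mx 0 k) z : R^o)).
- by near=> q; apply/esym/gE; near: q; exact: chart_nbhs.
- apply: is_derive_eq; first exact: is_derive_lincomb.
rewrite big_split/= -gE//; congr (_ + _).
have := metric_bilin ip; have := christoffel_bilin D ip => cb gb.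
under eq_bigr => k _ do rewrite gD// !cov_cst mulrDr.
rewrite big_split/= -gE//; congr (_ + _).
rewrite {2}(row_sum_delta (F p)) (bilin_sumr cb) (bilin_suml gb).
by apply: eq_bigr => k _; rewrite (bilinZr cb) (bilinZl gb).
Unshelve. all: by end_near. Qed.

Variables Dc Ds : connection M.
Hypothesis chernDc : is_chern Dc.
Hypothesis stromDs : is_strominger Ds.

Let C := christoffel Dc i.
Let c q x y := christoffel Ds i q x y - C q x y.
Let T q x y := C q x y - C q y x.

Let C_Jr q x y : chart_image i q -> C q x (J0 y) = J0 (C q x y).
Proof.
by move=> iq; rewrite /C -!cov_cst; case: chernDc => _ /(_ i q iq x y).
Qed.

Let S_Jr q x y : chart_image i q ->
  christoffel Ds i q x (J0 y) = J0 (christoffel Ds i q x y).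
Proof.
by move=> iq; rewrite -!cov_cst; case: stromDs => _ /(_ i q iq x y).
Qed.

Let J0S := linearS (@J0_linear R n).
Let J0D u v : @J0 R n (u + v) = J0 u + J0 v. Proof. by case: J0S. Qed.
Let J0N u : @J0 R n (- u) = - J0 u. Proof. by case: J0S. Qed.

(** Add the vanishing of the (1,1)-torsion at [x], [J0 y] to [J0] of its vanishing at [x], [y]: the
    terms with [x] and [y] exchanged cancel. *)
Lemma chern_christoffel_Jl q x y : chart_image i q -> C q (J0 x) y = J0 (C q x y).
Proof.
move=> iq; case: chernDc => _ _ /(_ i q iq) T11.
have Cb : bilin (C q) by exact: christoffel_bilin.
have T0 u v : T q u v + T q (J0 u) (J0 v) = 0.
  have /eqP := T11 u v; rewrite /part11 !torsion_atE scaler_eq0 invr_eq0.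
  by rewrite pnatr_eq0 /= => /eqP.
have e1 := T0 x (J0 y); have e2 := congr1 (@J0 R n) (T0 x y).
move: e1 e2; rewrite /T !(C_Jr, J0D, J0N, J0K, bilinE Cb)//.
have J00 : @J0 R n 0 = 0.
  by case: J0S => _ _ JZ; rewrite -[in LHS](scale0r 0) JZ scale0r.
rewrite J00; move: (J0 (C q x y)) (C q (J0 y) x) (C q (J0 x) y) (J0 _).
move=> a b d f /rowP e1 /rowP e2; apply/rowP => j.
by move: (e1 j) (e2 j); rewrite !mxE; lra.
Qed.

Let c_metric q x y z : chart_image i q ->
  metric i q (c q x y) z = - metric i q (T q x y) z + metric i q y (T q x z).
Proof.
move=> iq.
have Cb : bilin (C q) by exact: christoffel_bilin.
have gb := metric_bilin iq.
have [gDc _ _] := chernDc; have [gDs _ ts] := stromDs.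
apply: (strominger_formula gb _ _ _ (@J0K R n) (T := T q) _ _ _ (c := c q)).
- exact: Defs.metric_sym.
- exact: metric_J.
- exact: J0_linear.
- split=> v a u w; rewrite /T !(bilinE Cb).
    by rewrite scalerBr opprD addrACA.
  by rewrite scalerBr opprD addrACA.
- by move=> u v; rewrite /T opprB.
- by move=> u v; rewrite /T chern_christoffel_Jl// C_Jr// J0D J0N.
- by move=> u v; rewrite /c S_Jr// C_Jr// J0D J0N.
- move=> u v w; have := gDc i q iq u v w; have := gDs i q iq u v w.
  rewrite !cov_cst => ->; rewrite /c !(bilinE gb) -/C; lra.
- move=> u v w; have [_] := ts i q iq u v w; rewrite !torsion_atE.
  have e a b : T q a b + c q a b - c q b a =
    christoffel Ds i q a b - christoffel Ds i q b a.
    by rewrite /T /c opprB addrACA; apply/rowP => k; rewrite !mxE; ring.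
  by rewrite !e.
Qed.

Variable p : V.
Hypothesis ip : chart_image i p.

Let dC u x y := 'D_u (fun q => C q x y) p.
Let dc u x y := 'D_u (fun q => c q x y) p.

Let C_diff x y : differentiable (fun q => C q x y) p.
Proof. exact: (@christoffel_smooth _ _ _ Dc i x y [::] p ip). Qed.
Let S_diff x y : differentiable (fun q => christoffel Ds i q x y) p.
Proof. exact: (@christoffel_smooth _ _ _ Ds i x y [::] p ip). Qed.
Let c_diff x y : differentiable (fun q => c q x y) p.
Proof. exact: differentiableB. Qed.

Let C_bilin q : chart_image i q -> bilin (C q).
Proof. exact: christoffel_bilin. Qed.
Let c_bilin q : chart_image i q -> bilin (c q).
Proof.
move=> iq; have Cb := C_bilin iq; have Sb := christoffel_bilin Ds iq.
split=> v a u w; rewrite /c !(bilinE Cb) !(bilinE Sb).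
  by rewrite scalerBr opprD addrACA.
by rewrite scalerBr opprD addrACA.
Qed.

Let dC_bilin u : bilin (dC u).
Proof.
exact: (bilin_derive u (@image_open _ _ M i) ip C_bilin C_diff).
Qed.
Let dc_bilin u : bilin (dc u).
Proof.
exact: (bilin_derive u (@image_open _ _ M i) ip c_bilin c_diff).
Qed.

Let derive_near_J0 (F H : V -> V) u : differentiable H p ->
  (forall q, chart_image i q -> F q = J0 (H q)) -> 'D_u F p = J0 ('D_u H p).
Proof.
move=> dH FH; rewrite -(derive_linear (@J0_linear R n)); last exact: diff_derivable.
apply: near_eq_derive; near=> q; apply: FH; near: q; exact: chart_nbhs.
Unshelve. all: by end_near. Qed.

(** The derivative of [c_metric], which holds on a neighbourhood of [p]. Symmetry of the metric
    first brings the varying vector into the first slot, as [is_derive_metric] requires. *)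
Let dc_metric u x y z :
  metric i p (dc u x y) z + (metric i p (C p u (c p x y)) z
    + metric i p (c p x y) (C p u z)) =
  - (metric i p (dC u x y - dC u y x) z + (metric i p (C p u (T p x y)) z
    + metric i p (T p x y) (C p u z))) +
  (metric i p y (dC u x z - dC u z x) + (metric i p (C p u y) (T p x z)
    + metric i p y (C p u (T p x z)))).
Proof.
have [gD _ _] := chernDc.
have dm F z' := @is_derive_metric Dc F p u z' gD ip.
have dT a b : derivable (fun q => T q a b) p u.
  by apply: derivableB; exact: diff_derivable.
have eT a b : 'D_u (fun q => T q a b) p = dC u a b - dC u b a.
  by rewrite -deriveB//; exact: diff_derivable.
have dcm := dm _ z (diff_derivable (c_diff x y)).
have dTz := dm _ z (dT x y); have dTy := dm _ y (dT x z).
have [_ <-] := dcm.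
rewrite (@near_eq_derive _ _ _ _ (- (fun q => metric i q (T q x y) z : R^o)
  + (fun q => metric i q (T q x z) y : R^o))); last first.
  near=> q; have iq : chart_image i q by near: q; exact: chart_nbhs.
  by rewrite c_metric// (Defs.metric_sym iq y).
rewrite derive_val !eT !(Defs.metric_sym ip y) !(Defs.metric_sym ip (C p u y)).
by congr (_ + (_ + _)); rewrite addrC.
Unshelve. all: by end_near. Qed.

Let gauduchon_curvature r x y z :
  curvature_at (gauduchon Dc Ds r) i p x y z =
  curv (fun x y => C p x y + ((1 - r) / 2) *: c p x y)
    (fun u x y => dC u x y + ((1 - r) / 2) *: dc u x y) x y z.
Proof.
rewrite curvature_atE//.
have e : christoffel (gauduchon Dc Ds r) i =
    fun q a b => C q a b + ((1 - r) / 2) *: c q a b.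
  apply/funext => q; apply/funext => a; apply/funext => b.
  rewrite /= /gauduchon_christoffel /c -/C.
  by apply/rowP => k; rewrite !mxE; field.
have e' : (fun u a b => 'D_u (fun q => C q a b + ((1 - r) / 2) *: c q a b) p) =
    (fun u x y => dC u x y + ((1 - r) / 2) *: dc u x y).
  apply/funext => u; apply/funext => a; apply/funext => b.
  rewrite deriveD ?deriveZ//; try exact: diff_derivable.
  by apply: derivableZ; exact: diff_derivable.
by rewrite e e'.
Qed.

Lemma gauduchon_kahler_like_torsion_free r r' : r != r' ->
  kahler_like (gauduchon Dc Ds r) -> kahler_like (gauduchon Dc Ds r') ->
  forall x y, C p x y = C p y x.
Proof.
move=> rr' kl kl'.
have [e pe] := parseval_frame (metric_bilin ip) (Defs.metric_sym ip) (metric_pos ip).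
have bl s : kahler_like (gauduchon Dc Ds s) -> bianchi_like (metric i p) (@J0 R n)
    (curv (fun x y => C p x y + ((1 - s) / 2) *: c p x y)
      (fun u x y => dC u x y + ((1 - s) / 2) *: dc u x y)).
  move=> [_ kls] a b d f; have [h1 h2 _] := kls i p ip a b d f.
  by rewrite -!gauduchon_curvature; split.
have C_Jl a b : C p (J0 a) b = J0 (C p a b) by exact: chern_christoffel_Jl.
have c_Jr q a b : chart_image i q -> c q a (J0 b) = J0 (c q a b).
  by move=> iq; rewrite /c S_Jr// C_Jr// J0D J0N.
apply: (bianchi_like_torsion_eq0 (metric_bilin ip) (Defs.metric_sym ip)
  (metric_pos ip) (metric_J ip) (@J0_linear R n) (@J0K R n)
  (C_bilin ip) (c_bilin ip) dC_bilin _ dc_bilin _ C_Jl _ _ _ _ _ _ dc_metric pe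
  (t := (1 - r) / 2) (t' := (1 - r') / 2)).
- by move=> a b; exact: derive_direction_linear.
- by move=> a b; exact: derive_direction_linear.
- by move=> a b; exact: C_Jr.
- by move=> a b; exact: c_Jr.
- by move=> u a b; apply: derive_near_J0 => // q iq; exact: chern_christoffel_Jl.
- by move=> u a b; apply: derive_near_J0 => // q iq; exact: C_Jr.
- by move=> u a b; apply: derive_near_J0 => // q iq; exact: c_Jr.
- by move=> a b d; exact: c_metric.
- by apply: contra_neq rr' => h; lra.
- exact: bl kl.
- exact: bl kl'.
Qed.
End Hermitian.

(** * From a torsion-free Chern connection to a closed fundamental form *)

Theorem theorem2 (R : realType) (n : nat) (M : hermitianManifold R n)
    (Dc Ds : connection M) (r r' : R) :
  is_chern Dc -> is_strominger Ds -> r != r' ->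
  kahler_like (gauduchon Dc Ds r) -> kahler_like (gauduchon Dc Ds r') ->
  is_kahler M.
Proof.
move=> chernDc stromDs rr' kl kl' i p ip x y z.
have Csym := gauduchon_kahler_like_torsion_free chernDc stromDs ip rr' kl kl'.
have [gD JD _] := chernDc.
have CJ a b : christoffel Dc i p a (J0 b) = J0 (christoffel Dc i p a b).
  by rewrite -!cov_cst; exact: JD.
have gJ := g_Jl (metric_bilin ip) (metric_J ip) (@J0K R n).
have gC := Defs.metric_sym ip.
(* As g and J are parallel for Dc, the derivative of the fundamental form is a sum of six
   Christoffel terms. Symmetry of the symbols and skewness of [J0] cancel them in pairs. *)
rewrite /d_fundamental_form /fundamental_form !gD// !cov_cst !CJ !gJ.
rewrite (Csym y x) (Csym z x) (Csym z y) !(gC (christoffel _ _ _ _ _)) !gJ.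
lra.
Qed.
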